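(* Consider the single-parameter mutual activation model $$\dot X_1=f(X_2)-dX_1,\qquad \dot X_2=X_1-dX_2,$$ with $f:\mathbb{R}\to\mathbb{R}$ an unknown function and $d$ an unknown real parameter. Both $f$ and $d$ are structurally identifiable in either of the following cases: (i) only $X_2$ is observable; (ii) only $X_1$ is observable, provided $f$ is locally invertible and $d\neq 0$.
   Context: An ODE model has the form $\dot{\boldsymbol X}(t)=\boldsymbol F(\boldsymbol X;\boldsymbol f,\boldsymbol p)$, $\boldsymbol Y(t)=\boldsymbol H(\boldsymbol X(t))$, with state $\boldsymbol X\in\mathbb{R}^n$, observed output $\boldsymbol Y$ consisting of some or all of the state variables, known $\boldsymbol F,\boldsymbol H$, unknown scalar parameters $\boldsymbol p$, and unknown real-valued functions $\boldsymbol f$. Unknown functions are understood to be regular enough that solutions exist and the derivatives that occur make sense. Two choices of the unknowns give the same observed outputs if they produce the same output trajectory $\boldsymbol Y(t)$ for every initial condition consistent with prior knowledge of the initial conditions. Here the known initial conditions are $\boldsymbol Y(0)$; initial values of unobserved states are unknown and may differ between the two choices. Structural identifiability refers to the idealised case of arbitrary amounts of noiseless data, so that, in the differential equation involving only the observed variable, its derivatives and the unknowns (the input-output equation, obtained by eliminating the unobserved state), the observed variable and its lower-order derivatives are regarded as independently variable; two choices of unknowns are indistinguishable if they generate the same input-output equation. Fix a generic choice of the unknowns. An unknown function (or parameter) is (globally) structurally identifiable if every choice of the unknowns giving the same observed outputs as the fixed choice has the same value of that function (or parameter). $f$ is locally invertible if it contains no flat regions ($f'=0$ only at isolated points), so that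 $f$ is invertible on intervals whose union is dense. *)

(* Defs.v *)
From Stdlib Require Export Reals.
From Coquelicot Require Export Coquelicot.
Open Scope R_scope.

Record unknowns := Unknowns { fun_f : R -> R; par_d : R }.

(* Regularity of the unknown function: C^1, so that f' makes sense and the
   initial value problem is locally well posed.  The parameter is arbitrary. *)
Definition admissible (u : unknowns) : Prop :=
  forall x, ex_derive (fun_f u) x /\ continuous (Derive (fun_f u)) x.

(* Solutions live on [0, T): continuous up to the initial time and satisfying
   the equations for 0 < t < T.  Since f may grow superlinearly, solutions can
   blow up, so T is part of the data; values outside [0, T) are irrelevant. *)
Definition solution (u : unknowns) (T : R) (X1 X2 : R -> R) : Prop :=
  0 < T /\
  filterlim X1 (at_right 0) (locally (X1 0)) /\
  filterlim X2 (at_right 0) (locally (X2 0)) /\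
  forall t, 0 < t < T ->
    is_derive X1 t (fun_f u (X2 t) - par_d u * X1 t) /\
    is_derive X2 t (X1 t - par_d u * X2 t).

(* Observation map H of the output Y(t) = H (X1 t) (X2 t). *)
Definition observe_X1 (x1 x2 : R) : R := x1.
Definition observe_X2 (x1 x2 : R) : R := x2.

(* Every output of [u], from whatever initial state, is an output of [v].
   The outputs agree at t = 0 as well, where Y(0) is known; the initial value
   of the unobserved state may differ. *)
Definition outputs_included (H : R -> R -> R) (u v : unknowns) : Prop :=
  forall T X1 X2, solution u T X1 X2 ->
    exists Z1 Z2, solution v T Z1 Z2 /\
      forall t, 0 <= t < T -> H (Z1 t) (Z2 t) = H (X1 t) (X2 t).

Definition same_outputs (H : R -> R -> R) (u v : unknowns) : Prop :=
  outputs_included H u v /\ outputs_included H v u.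

(* Global structural identifiability, at the choice [u], of the component [q]
   of the unknowns when H is observed; the competing choice [v] is constrained
   only by regularity. *)
Definition structurally_identifiable (H : R -> R -> R) {A : Type}
    (q : unknowns -> A) (u : unknowns) : Prop :=
  forall v, admissible v -> same_outputs H u v -> q v = q u.

(* The zeros of f' are isolated ([locally'] is the punctured neighbourhood). *)
Definition locally_invertible (f : R -> R) : Prop :=
  forall x, Derive f x = 0 -> locally' x (fun y => Derive f y <> 0).

(* Main.v *)
Require Import Defs.
From Stdlib Require Import Reals Lra Lia Cantor ZArith ClassicalEpsilon FunctionalExtensionality.
From Coquelicot Require Import Coquelicot.
Open Scope R_scope.

(** Picard iteration gives a solution from every initial state, and letting t -> 0+ in the
    equations turns equality of outputs into pointwise relations between the unknowns
    u = (f, d) and v = (g, e).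

    If X2 is observed, eliminating X1 gives
    f x - g x = 2 (d - e) y + (d^2 - e^2) x for all x and y, hence d = e and f = g.

    If X1 is observed, the hidden states b (for u) and c (for v) are related by
    f b - g c = (d - e) a and by the time derivative of this equation, where a is the
    observed value.  The hidden state of the other model can jump between branches as a
    varies, but it stays in a level set of f or g consisting of isolated points, so by the
    Baire category theorem one and the same value serves a whole interval.
    - d = e: for fixed b with f' b <> 0 a single c serves two values of a, and comparing
      the two relations forces c = b (as d <> 0), so f b = g b.
    - d <> e: fixing the value y = f b and varying c gives, for each y, a differential
      equation for g on an interval where g' <> 0.  Two values of y force g' = A g + B;
      differentiating the remaining relation twice gives A = 0, so g is affine there.  Then
      every level y of f contains a point b, affine in y, with f' b = B - (d - e)^2.  This is
      impossible: either f has critical points at uncountably many levels, or f is affine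
      with a slope that forces d = e. *)

(** * Local existence of solutions *)

(** For [l <= r], the nearest-point retraction onto [[l, r]]. Being 1-Lipschitz, it serves both to
    freeze Picard iterates outside a time interval and to make a locally Lipschitz field globally
    Lipschitz. *)
Definition clamp (l r t : R) : R := Rmax l (Rmin r t).

Lemma clamp_lipschitz (l r s t : R) : Rabs (clamp l r s - clamp l r t) <= Rabs (s - t).
Proof.
unfold clamp, Rmax, Rmin.
repeat destruct (Rle_dec _ _); unfold Rabs; repeat destruct (Rcase_abs _); lra.
Qed.

Lemma clamp_bounds (l r t : R) : l <= r -> l <= clamp l r t <= r.
Proof. unfold clamp, Rmax, Rmin; repeat destruct (Rle_dec _ _); lra. Qed.

Lemma clamp_id (l r t : R) : l <= t <= r -> clamp l r t = t.
Proof. unfold clamp, Rmax, Rmin; repeat destruct (Rle_dec _ _); lra. Qed.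

Lemma lipschitz_continuous {U V : NormedModule R_AbsRing} (F : U -> V) (L : R) (x : U) :
  0 < L -> (forall y z, norm (minus (F y) (F z)) <= L * norm (minus y z)) ->
  continuous F x.
Proof.
intros hL hF.
apply (filterlim_locally_ball_norm (F := locally x)); intros eps.
assert (he : 0 < eps / L) by (apply Rdiv_lt_0_compat; [apply cond_pos | exact hL]).
apply (locally_le_locally_norm x).
exists (mkposreal _ he); intros y hy.
unfold ball_norm in *; simpl in hy.
eapply Rle_lt_trans; [apply hF |].
apply Rmult_lt_compat_l with (r := L) in hy; [| exact hL].
replace (L * (eps / L)) with (pos eps) in hy by (field; lra).
exact hy.
Qed.

Lemma clamp_continuous (l r t : R) : continuous (clamp l r) t.
Proof.
apply (lipschitz_continuous (U := R_NormedModule) (V := R_NormedModule) _ 1); [lra |].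
intros y z; rewrite Rmult_1_l; exact (clamp_lipschitz l r y z).
Qed.

Lemma minus_plus_plus {G : AbelianGroup} (x y z : G) :
  minus (plus x y) (plus x z) = minus y z.
Proof.
unfold minus; rewrite opp_plus, (plus_comm x y), <- plus_assoc, (plus_assoc x).
rewrite plus_opp_r, plus_zero_l; reflexivity.
Qed.

Section Picard.

Context {V : CompleteNormedModule R_AbsRing}.
Context (F : V -> V) (L : R) (x0 : V) (L_pos : 0 < L).
Context (F_lipschitz : forall y z, norm (minus (F y) (F z)) <= L * norm (minus y z)).

(** Since [L * h] is one half, the Picard operator over this length halves uniform distances. *)
Let h : R := / (2 * L).

(** Clamping the upper limit defines every iterate on the whole line, so the estimates are uniform
    in [t] and convergence can be sought in the space of functions on [R]. *)
Fixpoint picard (n : nat) : R -> V :=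
  match n with
  | O => fun _ => x0
  | S n => fun t => plus x0 (RInt (fun s => F (picard n s)) 0 (clamp 0 h t))
  end.

Let h_pos : 0 < h.
Proof. apply Rinv_0_lt_compat; lra. Qed.

Lemma lipschitz_integral_continuous (y : R -> V) (t : R) :
  (forall s, continuous y s) ->
  continuous (fun t => plus x0 (RInt (fun s => F (y s)) 0 (clamp 0 h t))) t.
Proof.
intros hy.
assert (hFy : forall s, continuous (fun s => F (y s)) s).
{ intros s; apply continuous_comp; [apply hy |].
  apply (lipschitz_continuous F L); assumption. }
apply (continuous_plus (V := V)); [apply continuous_const |].
apply (continuous_comp (clamp 0 h) (RInt (fun s => F (y s)) 0)).
- apply clamp_continuous.
- apply (ex_derive_continuous (K := R_AbsRing) (V := V)).
  eexists; apply (is_derive_RInt (fun s => F (y s)) _ 0); [| apply hFy].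
  apply filter_forall; intros r.
  apply RInt_correct, ex_RInt_continuous; intros; apply hFy.
Qed.

Lemma picard_continuous (n : nat) (t : R) : continuous (picard n) t.
Proof.
revert t; induction n as [|n IH]; intros t.
- apply continuous_const.
- apply lipschitz_integral_continuous; exact IH.
Qed.

Lemma F_picard_continuous (n : nat) (t : R) : continuous (fun s => F (picard n s)) t.
Proof.
apply continuous_comp; [apply picard_continuous |].
apply (lipschitz_continuous F L); assumption.
Qed.

Lemma picard_is_RInt (n : nat) (a b : R) :
  is_RInt (fun s => F (picard n s)) a b (RInt (fun s => F (picard n s)) a b).
Proof. apply RInt_correct, ex_RInt_continuous; intros; apply F_picard_continuous. Qed.

(** If consecutive iterates differ by at most [M], the next integrands differ by at most [L * M]
    over a length of at most [h], which gains a factor one half. *)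
Lemma picard_step (n : nat) (t : R) :
  norm (minus (picard (S n) t) (picard n t)) <= h * norm (F x0) * (/ 2) ^ n.
Proof.
revert t; induction n as [|n IH]; intros t.
- assert (hc := clamp_bounds 0 h t (Rlt_le _ _ h_pos)).
  simpl; rewrite RInt_const, Rmult_1_r.
  replace (minus (plus x0 _) x0) with (scal (clamp 0 h t - 0) (F x0)).
  2: { symmetry; etransitivity; [| apply minus_zero_r].
       etransitivity; [| apply (minus_plus_plus x0)].
       rewrite plus_zero_r; reflexivity. }
  eapply Rle_trans; [apply (norm_scal (K := R_AbsRing) (V := V)) |].
  apply Rmult_le_compat_r; [apply norm_ge_0 |].
  unfold abs; simpl; rewrite Rabs_pos_eq; lra.
- assert (hc := clamp_bounds 0 h t (Rlt_le _ _ h_pos)).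
  set (c := clamp 0 h t) in *.
  replace (minus (picard (S (S n)) t) (picard (S n) t)) with
    (minus (RInt (fun s => F (picard (S n) s)) 0 c) (RInt (fun s => F (picard n s)) 0 c)).
  2: { symmetry; apply (minus_plus_plus x0). }
  set (M := h * norm (F x0) * (/ 2) ^ n).
  apply Rle_trans with (scal (c - 0) (L * M)).
  + apply (norm_RInt_le (fun s => minus (F (picard (S n) s)) (F (picard n s)))
             (fun _ => L * M) 0 c); [lra | | |].
    * intros s hs; eapply Rle_trans; [apply F_lipschitz |].
      apply Rmult_le_compat_l; [lra | apply IH].
    * apply (is_RInt_minus (V := V)); apply picard_is_RInt.
    * apply (is_RInt_const (V := R_NormedModule)).
  + change (scal (c - 0) (L * M)) with ((c - 0) * (L * M)).
    assert (hM : 0 <= M).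
    { apply Rmult_le_pos; [apply Rmult_le_pos; [lra | apply norm_ge_0] | apply pow_le; lra]. }
    apply Rle_trans with (h * (L * M)).
    * apply Rmult_le_compat_r; [apply Rmult_le_pos; lra | lra].
    * right; unfold M, h; simpl; field; lra.
Qed.

Lemma picard_cauchy (n k : nat) (t : R) :
  norm (minus (picard (n + k) t) (picard n t)) <= 2 * (h * norm (F x0)) * (/ 2) ^ n.
Proof.
assert (hC : 0 <= h * norm (F x0)) by (apply Rmult_le_pos; [lra | apply norm_ge_0]).
(* The bound with the tail subtracted is the one that goes through the induction on [k]: each step
   adds one term of the geometric series. *)
apply Rle_trans with (2 * (h * norm (F x0)) * ((/ 2) ^ n - (/ 2) ^ (n + k))).
- induction k as [|k IH].
  + rewrite Nat.add_0_r, minus_eq_zero.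
    right; etransitivity; [apply (norm_zero (V := V)) | ring].
  + replace (n + S k)%nat with (S (n + k)) by lia.
    rewrite (minus_trans (picard (n + k) t)).
    eapply Rle_trans; [apply (norm_triangle (V := V)) |].
    assert (hs := picard_step (n + k) t).
    simpl ((/ 2) ^ S (n + k)).
    eapply Rle_trans; [apply Rplus_le_compat; [apply hs | apply IH] |].
    right; field.
- apply Rmult_le_compat_l; [lra |].
  assert (0 < (/ 2) ^ (n + k)) by (apply pow_lt; lra); lra.
Qed.

Lemma picard_converges :
  exists x : fct_UniformSpace R V,
    filterlim (picard : nat -> fct_UniformSpace R V) eventually (locally x).
Proof.
apply (filterlim_locally_cauchy (U := @fct_CompleteSpace R V)).
intros eps.
set (C := 2 * (h * norm (F x0))).
assert (hC : 0 <= C) by (apply Rmult_le_pos; [lra | apply Rmult_le_pos; [lra | apply norm_ge_0]]).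
assert (hN : exists N, forall n, (N <= n)%nat -> C * (/ 2) ^ n < eps).
(* [C] may be zero, hence the divisor [C + 1]. *)
{ destruct (pow_lt_1_zero (/ 2)) with (y := eps / (C + 1)) as [N hN].
  - rewrite Rabs_pos_eq; lra.
  - apply Rdiv_lt_0_compat; [apply cond_pos | lra].
  - exists N; intros n hn; specialize (hN n hn).
    rewrite Rabs_pos_eq in hN by (apply pow_le; lra).
    apply Rmult_lt_compat_l with (r := C + 1) in hN; [| lra].
    replace ((C + 1) * (eps / (C + 1))) with (pos eps) in hN by (field; lra).
    assert (0 < (/ 2) ^ n) by (apply pow_lt; lra); nra. }
destruct hN as [N hN].
exists (fun n => (N <= n)%nat); split; [exists N; auto |].
assert (key : forall n m, (N <= n <= m)%nat -> forall t, norm (minus (picard m t) (picard n t)) < eps).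
{ intros n m hnm t; replace m with (n + (m - n))%nat by lia.
  eapply Rle_lt_trans; [apply picard_cauchy | apply hN; lia]. }
intros n m hn hm t.
destruct (Nat.le_ge_cases n m).
- apply (norm_compat1 (V := V)), key; lia.
- apply (ball_sym (M := V)), (norm_compat1 (V := V)), key; lia.
Qed.

(** The uniform limit of the iterates is continuous and satisfies the integral equation, which can
    be differentiated where the clamp is inactive. *)
Lemma picard_lindelof :
  exists (x : R -> V) (T : R), 0 < T /\ x 0 = x0 /\ (forall t, continuous x t) /\
    forall t, 0 < t < T -> is_derive x t (F (x t)).
Proof.
destruct picard_converges as [x hx].
assert (hpt : forall t, filterlim (fun n => picard n t) eventually (locally (x t))).
{ intros t; apply filterlim_locally; intros eps.
  generalize (proj1 (filterlim_locally _ _) hx eps); apply filter_imp; intros n hn; apply hn. }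
assert (hcont : forall t, continuous x t).
{ intros t.
  destruct (filterlim_switch (U := V) eventually _ (locally t) _ picard x (fun n => picard n t)) as [l [h1 h2]]; [exact hx | |].
  - intros n; apply picard_continuous.
  - replace l with (x t) in h2; [exact h2 |].
    exact (filterlim_locally_unique _ _ _ (hpt t) h1). }
assert (hF : filterlim (fun (n : nat) s => F (picard n s)) eventually
               (locally ((fun s => F (x s)) : fct_UniformSpace R V))).
{ apply (filterlim_locally (U := fct_UniformSpace R V)); intros eps.
  assert (hk : 0 < @norm_factor _ V * L).
  { apply Rmult_lt_0_compat; [apply norm_factor_gt_0 | lra]. }
  assert (he : 0 < eps / (@norm_factor _ V * L)).
  { apply Rdiv_lt_0_compat; [apply cond_pos | exact hk]. }
  generalize (proj1 (filterlim_locally _ _) hx (mkposreal _ he)); apply filter_imp.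
  intros n hn s; apply (norm_compat1 (V := V)).
  eapply Rle_lt_trans; [apply F_lipschitz |].
  assert (hb := norm_compat2 (V := V) _ _ _ (hn s)); simpl in hb.
  apply Rmult_lt_compat_l with (r := L) in hb; [| lra].
  eapply Rlt_le_trans; [apply hb |].
  right; field; split; [lra | apply Rgt_not_eq, norm_factor_gt_0]. }
assert (hint : forall t, x t = plus x0 (RInt (fun s => F (x s)) 0 (clamp 0 h t))).
{ intros t.
  destruct (filterlim_RInt (V := V) (fun n s => F (picard n s)) 0 (clamp 0 h t) eventually
     eventually_filter (fun s => F (x s)) (fun n => RInt (fun s => F (picard n s)) 0 (clamp 0 h t)))
    as [I [h1 h2]].
  - intros n; apply picard_is_RInt.
  - exact hF.
  - rewrite (is_RInt_unique _ _ _ _ h2).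
    (* The integral of the [n]-th iterate gives the iterate of index [S n], and the shifted sequence
       has the same limit. *)
    apply (filterlim_locally_unique (fun n => picard (S n) t) (x t) (plus x0 I) (F := eventually)).
    + intros P hP; specialize (hpt t P hP); destruct hpt as [N hN].
      exists N; intros n hn; apply hN; lia.
    + apply (filterlim_comp_2 (F := eventually) (G := locally x0) (H := locally I)
               (fun _ => x0) _ plus); [apply filterlim_const | exact h1 | apply (filterlim_plus (V := V))]. }
exists x, h; split; [exact h_pos |]; split; [| split].
- rewrite hint, clamp_id by lra; rewrite RInt_point, plus_zero_r; reflexivity.
- exact hcont.
- intros t ht.
  apply (is_derive_ext_loc (fun t => plus x0 (RInt (fun s => F (x s)) 0 t))).
  + apply (locally_interval _ t 0 h); simpl; try lra.
    intros y h1 h2; rewrite (hint y), clamp_id by lra; reflexivity.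
  + rewrite <- (plus_zero_l (F (x t))).
    apply (is_derive_plus (V := V) (fun _ => x0)); [apply (is_derive_const (K := R_AbsRing) (V := V)) |].
    assert (hFx : forall s, continuous (fun s => F (x s)) s).
    { intros s; apply continuous_comp; [apply hcont |].
      apply (lipschitz_continuous F L); assumption. }
    apply (is_derive_RInt (fun s => F (x s)) _ 0); [| apply hFx].
    apply filter_forall; intros r; apply RInt_correct, ex_RInt_continuous; intros; apply hFx.
Qed.

End Picard.

Lemma C1_lipschitz_on (f : R -> R) (l r : R) :
  l <= r -> (forall x, ex_derive f x) -> (forall x, continuous (Derive f) x) ->
  exists M, 0 < M /\ forall x y, l <= x <= r -> l <= y <= r ->
    Rabs (f x - f y) <= M * Rabs (x - y).
Proof.
intros hlr hd hc.
assert (hD : forall x, l <= x <= r -> continuity_pt (Derive f) x).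
{ intros x _; apply continuity_pt_filterlim, hc. }
destruct (continuity_ab_maj _ _ _ hlr hD) as [M1 [h1 _]].
destruct (continuity_ab_min _ _ _ hlr hD) as [M2 [h2 _]].
set (M := Rabs (Derive f M1) + Rabs (Derive f M2) + 1).
exists M; split.
{ unfold M; assert (a1 := Rabs_pos (Derive f M1)); assert (a2 := Rabs_pos (Derive f M2)); lra. }
intros x y hx hy.
destruct (MVT_gen f y x (Derive f)) as [c [hc1 hc2]].
- intros z _; apply Derive_correct, hd.
- intros z _; apply continuity_pt_filterlim, (ex_derive_continuous (V := R_NormedModule)), hd.
- rewrite hc2, Rabs_mult; apply Rmult_le_compat_r; [apply Rabs_pos |].
  assert (hcr : l <= c <= r).
  { revert hc1; unfold Rmin, Rmax; repeat destruct (Rle_dec _ _); lra. }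
  specialize (h1 c hcr); specialize (h2 c hcr).
  unfold M, Rabs; repeat destruct (Rcase_abs _); lra.
Qed.

Lemma is_derive_fst (x : R -> C) (t : R) (l : C) :
  is_derive (V := C_R_NormedModule) x t l ->
  is_derive (fun s => fst (x s)) t (fst l).
Proof.
intros hx.
apply (filterdiff_comp' (K := R_AbsRing) (V := C_R_NormedModule) (W := R_NormedModule)
         x fst t _ fst hx).
apply filterdiff_linear, (is_linear_fst (U := R_NormedModule) (V := R_NormedModule)).
Qed.

Lemma is_derive_snd (x : R -> C) (t : R) (l : C) :
  is_derive (V := C_R_NormedModule) x t l ->
  is_derive (fun s => snd (x s)) t (snd l).
Proof.
intros hx.
apply (filterdiff_comp' (K := R_AbsRing) (V := C_R_NormedModule) (W := R_NormedModule)
         x snd t _ snd hx).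
apply filterdiff_linear, (is_linear_snd (U := R_NormedModule) (V := R_NormedModule)).
Qed.

Lemma continuous_at_right (f : R -> R) (x : R) :
  continuous f x -> filterlim f (at_right x) (locally (f x)).
Proof.
intros hf P hP; destruct (hf P hP) as [e he].
exists e; intros y hy _; apply he, hy.
Qed.

(** As [f] is only locally Lipschitz, its argument is first clamped to [[b - 1, b + 1]]. By
    continuity the second component stays in this interval for a short time, during which the
    clamped and the original equations agree. *)
Lemma solution_exists (u : unknowns) (a b : R) :
  admissible u -> exists T X1 X2, solution u T X1 X2 /\ X1 0 = a /\ X2 0 = b.
Proof.
intros hu.
destruct u as [f d]; unfold admissible in hu; simpl in hu.
destruct (C1_lipschitz_on f (b - 1) (b + 1)) as [M [hM hf]];
  [lra | apply hu | apply hu |].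
set (k := clamp (b - 1) (b + 1)).
set (F := fun z : C_R_CompleteNormedModule =>
            (f (k (snd z)) - d * fst z, fst z - d * snd z) : C_R_CompleteNormedModule).
(* The plane is normed by the complex modulus, which is at most [sqrt 2] times the larger
   coordinate. The coordinates of the field have Lipschitz constants [M + Rabs d] and
   [1 + Rabs d]. *)
set (L := sqrt 2 * (M + 2 * Rabs d + 1)).
assert (hs : 0 < sqrt 2) by (apply sqrt_lt_R0; lra).
assert (hd := Rabs_pos d).
assert (hL : 0 < L) by (apply Rmult_lt_0_compat; lra).
destruct (picard_lindelof F L ((a, b) : C_R_CompleteNormedModule) hL)
  as [x [T [hT [hx0 [hxc hx]]]]].
{ intros y z.
  assert (hn : forall w : C_R_CompleteNormedModule, norm w = Cmod w).
  { intros w; symmetry; apply Cmod_norm. }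
  rewrite !hn.
  change (Cmod (Cminus (F y) (F z)) <= L * Cmod (Cminus y z)).
  assert (hy := Rmax_Cmod (Cminus y z)).
  eapply Rle_trans; [apply Cmod_2Rmax |].
  unfold L; rewrite Rmult_assoc; apply Rmult_le_compat_l; [lra |].
  set (N := Cmod (Cminus y z)) in *; simpl in hy.
  assert (h1 := Rle_trans _ _ _ (Rmax_l _ _) hy); assert (h2 := Rle_trans _ _ _ (Rmax_r _ _) hy).
  fold (Rminus (fst y) (fst z)) in h1; fold (Rminus (snd y) (snd z)) in h2.
  assert (hN : 0 <= N) by (eapply Rle_trans; [apply Rabs_pos | exact h1]).
  assert (hk : Rabs (f (k (snd y)) - f (k (snd z))) <= M * N).
  { eapply Rle_trans; [apply hf; apply clamp_bounds; lra |].
    apply Rmult_le_compat_l; [lra |].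
    eapply Rle_trans; [apply clamp_lipschitz | exact h2]. }
  assert (hd1 : Rabs (d * (fst y - fst z)) <= Rabs d * N).
  { rewrite Rabs_mult; apply Rmult_le_compat_l; lra. }
  assert (hd2 : Rabs (d * (snd y - snd z)) <= Rabs d * N).
  { rewrite Rabs_mult; apply Rmult_le_compat_l; lra. }
  assert (hdN : 0 <= Rabs d * N) by (apply Rmult_le_pos; lra).
  assert (hMN : 0 <= M * N) by (apply Rmult_le_pos; lra).
  simpl; apply Rmax_lub.
  - replace (_ + - _) with ((f (k (snd y)) - f (k (snd z))) + - (d * (fst y - fst z))) by ring.
    eapply Rle_trans; [apply Rabs_triang |]; rewrite Rabs_Ropp; lra.
  - replace (_ + - _) with ((fst y - fst z) + - (d * (snd y - snd z))) by ring.
    eapply Rle_trans; [apply Rabs_triang |]; rewrite Rabs_Ropp; lra. }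
assert (hc1 : forall t, continuous (fun s => fst (x s)) t).
{ intros t; apply (continuous_comp x fst); [apply hxc |].
  apply (continuous_fst (U := R_UniformSpace) (V := R_UniformSpace)). }
assert (hc2 : forall t, continuous (fun s => snd (x s)) t).
{ intros t; apply (continuous_comp x snd); [apply hxc |].
  apply (continuous_snd (U := R_UniformSpace) (V := R_UniformSpace)). }
destruct (proj1 (filterlim_locally _ _) (hc2 0) (mkposreal 1 Rlt_0_1)) as [eps heps].
rewrite hx0 in heps; simpl in heps.
exists (Rmin T eps), (fun s => fst (x s)), (fun s => snd (x s)).
split; [| rewrite hx0; split; reflexivity].
split; [apply Rmin_pos; [exact hT | apply cond_pos] |].
split; [| split].
- apply continuous_at_right, hc1.
- apply continuous_at_right, hc2.
- intros t ht.
  assert (ht1 := Rmin_l T eps); assert (ht2 := Rmin_r T eps).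
  assert (hder := hx t ltac:(lra)).
  assert (hk : k (snd (x t)) = snd (x t)).
  { apply clamp_id.
    assert (hb : Rabs (snd (x t) - b) < 1).
    { apply heps; change (Rabs (t - 0) < eps); rewrite Rabs_pos_eq; lra. }
    apply Rabs_def2 in hb; lra. }
  split.
  + apply is_derive_fst in hder; simpl in hder; rewrite hk in hder; exact hder.
  + apply is_derive_snd in hder; exact hder.
Qed.

(** * Pointwise consequences of equal outputs *)

Lemma derive_eq_on (h k : R -> R) (l r t a b : R) :
  l < t < r -> (forall s, l < s < r -> h s = k s) ->
  is_derive h t a -> is_derive k t b -> a = b.
Proof.
intros ht heq hh hk.
rewrite <- (is_derive_unique _ _ _ hk); symmetry; apply is_derive_unique.
apply (is_derive_ext_loc h); [| exact hh].
apply (locally_interval _ t l r); simpl; try lra.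
intros y h1 h2; apply heq; lra.
Qed.

Lemma is_derive_comp_R (f g : R -> R) (x a b : R) :
  is_derive f (g x) a -> is_derive g x b -> is_derive (fun s => f (g s)) x (a * b).
Proof.
intros hf hg; rewrite Rmult_comm; exact (is_derive_comp f g x a b hf hg).
Qed.

Lemma filterlim_comp_continuous {T} {F : (T -> Prop) -> Prop} (phi : R -> R) (f : T -> R) (a : R) :
  continuous phi a -> filterlim f F (locally a) ->
  filterlim (fun t => phi (f t)) F (locally (phi a)).
Proof. intros hphi hf; exact (filterlim_comp _ _ _ _ _ _ _ _ hf hphi). Qed.

Lemma filterlim_Rplus {T} {F : (T -> Prop) -> Prop} {FF : Filter F} (f g : T -> R) (a b : R) :
  filterlim f F (locally a) -> filterlim g F (locally b) ->
  filterlim (fun t => f t + g t) F (locally (a + b)).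
Proof.
intros hf hg; apply (filterlim_comp_2 _ _ Rplus hf hg).
apply (filterlim_plus (V := R_NormedModule)).
Qed.

Lemma filterlim_Rmult {T} {F : (T -> Prop) -> Prop} {FF : Filter F} (f g : T -> R) (a b : R) :
  filterlim f F (locally a) -> filterlim g F (locally b) ->
  filterlim (fun t => f t * g t) F (locally (a * b)).
Proof.
intros hf hg; apply (filterlim_comp_2 _ _ Rmult hf hg).
apply (filterlim_mult (K := R_AbsRing)).
Qed.

Lemma filterlim_Ropp {T} {F : (T -> Prop) -> Prop} {FF : Filter F} (f : T -> R) (a : R) :
  filterlim f F (locally a) -> filterlim (fun t => - f t) F (locally (- a)).
Proof.
intros hf; apply (filterlim_comp _ _ _ f Ropp F (locally a) _ hf).
apply (filterlim_opp (V := R_NormedModule)).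
Qed.

Lemma filterlim_Rminus {T} {F : (T -> Prop) -> Prop} {FF : Filter F} (f g : T -> R) (a b : R) :
  filterlim f F (locally a) -> filterlim g F (locally b) ->
  filterlim (fun t => f t - g t) F (locally (a - b)).
Proof. intros hf hg; apply filterlim_Rplus; [exact hf | apply filterlim_Ropp, hg]. Qed.

Ltac limits := repeat
  match goal with
  | |- filterlim (fun t => _ + _) _ _ => apply filterlim_Rplus
  | |- filterlim (fun t => _ - _) _ _ => apply filterlim_Rminus
  | |- filterlim (fun t => _ * _) _ _ => apply filterlim_Rmult
  | |- filterlim _ _ _ => assumption
  | |- filterlim (Rmult ?k) _ _ => apply (filterlim_Rmult (fun _ => k) (fun t => t))
  | |- filterlim (fun t => ?phi (?X t)) _ _ => apply filterlim_comp_continuous; [auto | assumption]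
  | |- filterlim (fun t => _) _ _ => apply filterlim_const
  end.

(** The equations hold only for positive times, so identities along a trajectory reach the initial
    state through a one-sided limit. *)
Lemma at_right_zero_limit (h : R -> R) (T l : R) :
  0 < T -> (forall t, 0 < t < T -> h t = 0) ->
  filterlim h (at_right 0) (locally l) -> l = 0.
Proof.
intros hT h0 hl.
apply (filterlim_locally_unique (F := at_right 0) h l 0 hl).
apply (filterlim_ext_loc (fun _ => 0)); [| apply filterlim_const].
exists (mkposreal T hT); intros t ht ht0; symmetry; apply h0.
change (Rabs (t - 0) < T) in ht; apply Rabs_def2 in ht; lra.
Qed.

Lemma admissible_continuous (u : unknowns) (x : R) : admissible u -> continuous (fun_f u) x.
Proof. intros hu; apply (ex_derive_continuous (V := R_NormedModule)), hu. Qed.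

Lemma observe_X2_relation (u v : unknowns) :
  admissible u -> admissible v -> outputs_included observe_X2 u v ->
  forall x y, fun_f u x - fun_f v x
    = 2 * (par_d u - par_d v) * y + (par_d u ^ 2 - par_d v ^ 2) * x.
Proof.
intros hu hv huv x y.
(* This initial state makes the output start at the value [x] with derivative tending to [y]. *)
destruct (solution_exists u (y + par_d u * x) x hu) as [T [X1 [X2 [hX [h1 h2]]]]].
destruct (huv T X1 X2 hX) as [Z1 [Z2 [hZ hobs]]].
unfold observe_X2 in hobs.
destruct hX as [hT [hX1 [hX2 hX]]]; destruct hZ as [_ [_ [_ hZ]]].
rewrite h1 in hX1; rewrite h2 in hX2.
assert (hfu := fun z => admissible_continuous u z hu).
assert (hfv := fun z => admissible_continuous v z hv).
destruct u as [f d]; destruct v as [g e]; simpl in *.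
(* First derivatives of the outputs determine the hidden state [Z1]; differentiating the resulting
   formula for [Z1] then gives [key]. *)
assert (hZ1 : forall t, 0 < t < T -> Z1 t = X1 t - d * X2 t + e * X2 t).
{ intros t ht.
  assert (he : X1 t - d * X2 t = Z1 t - e * Z2 t).
  { apply (derive_eq_on X2 Z2 0 T t); [exact ht | | apply hX | apply hZ]; try exact ht.
    intros s hs; symmetry; apply hobs; lra. }
  rewrite (hobs t) in he by lra; lra. }
assert (key : forall t, 0 < t < T ->
  f (X2 t) - d * X1 t - (d - e) * (X1 t - d * X2 t) - g (X2 t)
    + e * (X1 t - d * X2 t + e * X2 t) = 0).
{ intros t ht.
  assert (he : g (Z2 t) - e * Z1 t
     = f (X2 t) - d * X1 t - d * (X1 t - d * X2 t) + e * (X1 t - d * X2 t)).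
  { destruct (hX t ht) as [d1 d2].
    apply (derive_eq_on Z1 (fun s => X1 s - d * X2 s + e * X2 s) 0 T t);
      [exact ht | exact hZ1 | apply hZ, ht |].
    apply (is_derive_plus (V := R_NormedModule)).
    - apply (is_derive_minus (V := R_NormedModule)); [exact d1 |].
      apply is_derive_scal; exact d2.
    - apply is_derive_scal; exact d2. }
  rewrite (hZ1 t ht), (hobs t) in he by lra; lra. }
assert (hl := at_right_zero_limit _ T
  (f x - d * (y + d * x) - (d - e) * ((y + d * x) - d * x) - g x
     + e * ((y + d * x) - d * x + e * x)) hT key ltac:(limits)).
lra.
Qed.

(** The witness is the initial hidden state of the matching solution of [v]. The first relation
    compares the derivatives of the two outputs; the second is its time derivative along the
    trajectories. *)
Lemma observe_X1_relation (u v : unknowns) :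
  admissible u -> admissible v -> outputs_included observe_X1 u v ->
  forall a b, exists c,
    fun_f u b - fun_f v c = (par_d u - par_d v) * a /\
    Derive (fun_f u) b * (a - par_d u * b) - Derive (fun_f v) c * (a - par_d v * c)
      = (par_d u - par_d v) * (fun_f u b - par_d u * a).
Proof.
intros hu hv huv a b.
destruct (solution_exists u a b hu) as [T [X1 [X2 [hX [h1 h2]]]]].
destruct (huv T X1 X2 hX) as [Z1 [Z2 [hZ hobs]]].
unfold observe_X1 in hobs.
destruct hX as [hT [hX1 [hX2 hX]]]; destruct hZ as [_ [_ [hZ2 hZ]]].
rewrite h1 in hX1; rewrite h2 in hX2.
assert (hfu := fun z => admissible_continuous u z hu).
assert (hfv := fun z => admissible_continuous v z hv).
destruct u as [f d]; destruct v as [g e]; unfold admissible in *; simpl in *.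
assert (hdf := fun z => proj2 (hu z)); assert (hdg := fun z => proj2 (hv z)).
assert (key1 : forall t, 0 < t < T -> f (X2 t) - g (Z2 t) - (d - e) * X1 t = 0).
{ intros t ht.
  assert (he : f (X2 t) - d * X1 t = g (Z2 t) - e * Z1 t).
  { apply (derive_eq_on X1 Z1 0 T t); [exact ht | | apply hX | apply hZ]; try exact ht.
    intros s hs; symmetry; apply hobs; lra. }
  rewrite (hobs t) in he by lra; lra. }
assert (key2 : forall t, 0 < t < T ->
  Derive f (X2 t) * (X1 t - d * X2 t) - Derive g (Z2 t) * (X1 t - e * Z2 t)
    - (d - e) * (f (X2 t) - d * X1 t) = 0).
{ intros t ht.
  destruct (hX t ht) as [d1 d2]; destruct (hZ t ht) as [_ d3].
  rewrite (hobs t) in d3 by lra.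
  apply (derive_eq_on (fun s => f (X2 s) - g (Z2 s) - (d - e) * X1 s) (fun _ => 0) 0 T t);
    [exact ht | exact key1 | | apply (is_derive_const (K := R_AbsRing) (V := R_NormedModule))].
  apply (is_derive_minus (V := R_NormedModule)); [apply (is_derive_minus (V := R_NormedModule)) |].
  - apply is_derive_comp_R; [apply Derive_correct, hu | exact d2].
  - apply is_derive_comp_R; [apply Derive_correct, hv | exact d3].
  - apply is_derive_scal; exact d1. }
exists (Z2 0); split.
- assert (hl := at_right_zero_limit _ T (f b - g (Z2 0) - (d - e) * a) hT key1
    ltac:(limits)).
  lra.
- assert (hl := at_right_zero_limit _ T
    (Derive f b * (a - d * b) - Derive g (Z2 0) * (a - e * Z2 0) - (d - e) * (f b - d * a))
    hT key2 ltac:(limits)).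
  lra.
Qed.

(** * Covering an interval by isolated choices *)

(** If no [E n] contained an interval, every interval could be shrunk to a closed one that misses
    [E n]. Shrinking for each [n] in turn leaves a common point that lies in no [E n]. *)
Lemma baire_interval (E : nat -> R -> Prop) (l r : R) :
  l < r -> (forall n, closed (E n)) -> (forall x, l < x < r -> exists n, E n x) ->
  exists n p q, l <= p /\ p < q /\ q <= r /\ forall x, p < x < q -> E n x.
Proof.
intros hlr hclosed hcover; apply NNPP; intros hno.
assert (hstep : forall n p q, l <= p -> p < q -> q <= r ->
  exists p' q', p < p' /\ p' < q' /\ q' < q /\ forall x, p' <= x <= q' -> ~ E n x).
{ intros n p q hp hpq hq.
  assert (hx : exists x, p < x < q /\ ~ E n x).
  { apply NNPP; intros hx; apply hno; exists n, p, q; repeat split; trivial.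
    intros x hxpq; apply NNPP; intros hE; apply hx; exists x; auto. }
  destruct hx as [x [hx hE]].
  assert (hloc : locally x (fun y => ~ E n y)).
  { apply NNPP; intros hloc; apply hE, hclosed, hloc. }
  destruct hloc as [eps heps]; assert (he := cond_pos eps).
  set (s := Rmin (eps / 2) (Rmin ((x - p) / 2) ((q - x) / 2))).
  assert (hs1 : s <= eps / 2) by apply Rmin_l.
  assert (hs2 : s <= (x - p) / 2) by (eapply Rle_trans; [apply Rmin_r | apply Rmin_l]).
  assert (hs3 : s <= (q - x) / 2) by (eapply Rle_trans; [apply Rmin_r | apply Rmin_r]).
  assert (hs : 0 < s) by (repeat apply Rmin_pos; lra).
  exists (x - s), (x + s); repeat split; try lra.
  intros y hy; apply heps; change (Rabs (y - x) < eps); apply Rabs_def1; lra. }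
set (valid := fun I : R * R => l <= fst I /\ fst I < snd I /\ snd I <= r).
(* With validity as a premise under the existential, a next interval exists for every pair, so that
   choice yields a total function. *)
assert (hnext : forall n (I : R * R), exists J : R * R, valid I ->
  fst I < fst J /\ fst J < snd J /\ snd J < snd I /\
  forall x, fst J <= x <= snd J -> ~ E n x).
{ intros n [p q]; destruct (classic (valid (p, q))) as [[h1 [h2 h3]] | hI].
  - destruct (hstep n p q h1 h2 h3) as [p' [q' hJ]]; exists (p', q'); intros _; exact hJ.
  - exists (p, q); intros hI'; contradiction. }
set (next := fun n I => proj1_sig (constructive_indefinite_description _ (hnext n I))).
assert (hnext' : forall n I, valid I -> fst I < fst (next n I) /\ fst (next n I) < snd (next n I)
   /\ snd (next n I) < snd I /\ forall x, fst (next n I) <= x <= snd (next n I) -> ~ E n x).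
{ intros n I; exact (proj2_sig (constructive_indefinite_description _ (hnext n I))). }
set (I := fix I n := match n with O => (l, r) | S n => next n (I n) end).
assert (hI : forall n, valid (I n)).
{ induction n as [|n IH]; [unfold valid; simpl; lra |].
  destruct (hnext' n (I n) IH) as [h1 [h2 [h3 _]]].
  unfold valid in *; simpl in *; lra. }
assert (hmono : forall n k, fst (I n) <= fst (I (k + n)%nat) /\ snd (I (k + n)%nat) <= snd (I n)).
{ intros n; induction k as [|k IH]; [simpl; lra |].
  destruct (hnext' (k + n)%nat _ (hI (k + n)%nat)) as [h1 [h2 [h3 _]]]; simpl in *; lra. }
assert (hlt : forall n m, fst (I n) < snd (I m)).
{ intros n m; assert (h1 := proj1 (hmono n m)); assert (h2 := proj2 (hmono m n)).
  assert (h3 := hI (n + m)%nat); rewrite (Nat.add_comm m n) in h1; unfold valid in h3; lra. }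
destruct (completeness (fun x => exists n, x = fst (I n))) as [x [hub hlub]].
- exists r; intros x [n ->]; assert (h := hlt n O); simpl in h; lra.
- exists l, O; reflexivity.
- assert (hx : forall n, fst (I n) <= x <= snd (I n)).
  { intros n; split; [apply hub; exists n; reflexivity |].
    apply hlub; intros y [m ->]; left; apply hlt. }
  destruct (hcover x) as [n hn].
  + destruct (hnext' O _ (hI O)) as [h1 [_ [h2 _]]]; assert (h := hx 1%nat); simpl in *; lra.
  + exact (proj2 (proj2 (proj2 (hnext' n _ (hI n)))) x (hx (S n)) hn).
Qed.

(* The number [i - j] is the integer part of [c * (m + 1)], where [1 / (m + 1)] isolates [c]
   in [S]; so [n] determines [c]. *)
Definition isolation_code (S : R -> Prop) (n : nat) (c : R) : Prop :=
  let (m, k) := Cantor.of_nat n in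
  let (i, j) := Cantor.of_nat k in
  S c /\ (forall y, S y -> Rabs (y - c) < / (INR m + 1) -> y = c) /\
  INR i - INR j <= c * (INR m + 1) < INR i - INR j + 1.

Lemma isolation_code_exists (S : R -> Prop) (c : R) :
  S c -> locally' c (fun y => ~ S y) -> exists n, isolation_code S n c.
Proof.
intros hS [eps heps].
destruct (archimed_cor1 eps (cond_pos eps)) as [m [hm hm0]].
set (z := Int_part (c * (INR m + 1))).
(* The integer [z] is stored as its positive and negative parts, at least one of which is zero. *)
exists (Cantor.to_nat (m, Cantor.to_nat (Z.to_nat z, Z.to_nat (- z)))).
unfold isolation_code; rewrite !Cantor.cancel_of_to.
assert (hmr : 0 < INR m) by (apply lt_0_INR; exact hm0).
split; [exact hS | split].
- intros y hy hyc; apply NNPP; intros hne; refine (heps y _ hne hy).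
  change (Rabs (y - c) < eps); eapply Rlt_trans; [exact hyc |].
  eapply Rlt_trans; [| exact hm]; apply Rinv_lt_contravar; nra.
- assert (hz : INR (Z.to_nat z) - INR (Z.to_nat (- z)) = IZR z).
  { rewrite !INR_IZR_INZ, <- minus_IZR; f_equal; lia. }
  rewrite hz; assert (hb := base_Int_part (c * (INR m + 1))); fold z in hb; lra.
Qed.

(** After scaling by [INR m + 1] both points lie in the same half-open unit interval, so they are
    closer than the isolation radius. *)
Lemma isolation_code_unique (S : R -> Prop) (n : nat) (c c' : R) :
  isolation_code S n c -> isolation_code S n c' -> c = c'.
Proof.
unfold isolation_code; destruct (Cantor.of_nat n) as [m k]; destruct (Cantor.of_nat k) as [i j].
intros [hS [_ hc]] [_ [hiso hc']]; apply hiso; [exact hS |].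
assert (hm := pos_INR m).
assert (hd : Rabs ((c - c') * (INR m + 1)) < 1) by (apply Rabs_def1; lra).
rewrite Rabs_mult, (Rabs_pos_eq (INR m + 1)) in hd by lra.
apply Rmult_lt_reg_r with (INR m + 1); [lra |]; rewrite Rinv_l; lra.
Qed.

(** Codes make [S] countable: the values of [a] served by a given code form either one closed slice
    of [P] or the empty set, so the Baire argument applies. *)
Lemma discrete_cover (S : R -> Prop) (P : R -> R -> Prop) (l r : R) :
  l < r -> (forall c, S c -> locally' c (fun y => ~ S y)) ->
  (forall c, S c -> closed (fun a => P a c)) ->
  (forall a, l < a < r -> exists c, S c /\ P a c) ->
  exists c p q, S c /\ l <= p /\ p < q /\ q <= r /\ forall a, p < a < q -> P a c.
Proof.
intros hlr hiso hclosed hcover.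
destruct (baire_interval (fun n a => exists c, isolation_code S n c /\ P a c) l r hlr)
  as [n [p [q [hp [hpq [hq hE]]]]]].
- intros n; destruct (classic (exists c, isolation_code S n c)) as [[c hc] | hc].
  + apply (closed_ext (fun a => P a c)).
    * intros a; split; [intros ha; exists c; auto |].
      intros [c' [hc' ha]]; rewrite (isolation_code_unique S n c c'); assumption.
    * apply hclosed; unfold isolation_code in hc.
      destruct (Cantor.of_nat n) as [m k]; destruct (Cantor.of_nat k) as [i j]; apply hc.
  + apply (closed_ext (fun _ => False)); [| apply closed_false].
    intros a; split; [tauto |]; intros [c [h _]]; apply hc; exists c; exact h.
- intros a ha; destruct (hcover a ha) as [c [hS hP]].
  destruct (isolation_code_exists S c hS (hiso c hS)) as [n hn]; exists n, c; auto.
- destruct (hE ((p + q) / 2) ltac:(lra)) as [c [hc _]]; exists c, p, q.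
  split; [| repeat split; trivial].
  + unfold isolation_code in hc.
    destruct (Cantor.of_nat n) as [m k]; destruct (Cantor.of_nat k) as [i j]; apply hc.
  + intros a ha; destruct (hE a ha) as [c' [hc' hP]].
    rewrite (isolation_code_unique S n c c'); assumption.
Qed.

Lemma closed_zero_set (h : R -> R) : (forall x, continuous h x) -> closed (fun x => h x = 0).
Proof. intros hh; apply (closed_comp h (fun y => y = 0)); [exact hh | apply closed_eq]. Qed.

(** By Rolle, another nearby point at the level of [c] would give a critical point strictly between
    the two. The derivative may vanish at [c] itself. *)
Lemma level_set_isolated (f : R -> R) (c : R) :
  (forall x, ex_derive f x) -> locally' c (fun y => Derive f y <> 0) ->
  locally' c (fun y => f y <> f c).
Proof.
intros hf [eps heps]; exists eps; intros y hy hyc heq.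
change (Rabs (y - c) < eps) in hy; apply Rabs_def2 in hy.
destruct (MVT_cor2 f (Derive f) (Rmin y c) (Rmax y c)) as [z [hz1 hz2]].
- unfold Rmin, Rmax; destruct (Rle_dec y c); lra.
- intros x _; apply is_derive_Reals, Derive_correct, hf.
- assert (hfz : Derive f z * (Rmax y c - Rmin y c) = 0).
  { rewrite <- hz1; unfold Rmin, Rmax; destruct (Rle_dec y c); lra. }
  revert hz2 hfz; unfold Rmin, Rmax; destruct (Rle_dec y c); intros hz2 hfz;
    apply Rmult_integral in hfz; (destruct hfz as [hfz | hfz]; [| lra]);
    (apply (heps z); [| lra | exact hfz]);
    change (Rabs (z - c) < eps); apply Rabs_def1; lra.
Qed.

Lemma locally_nonzero (h : R -> R) (c : R) :
  continuous h c -> h c <> 0 -> locally c (fun y => h y <> 0).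
Proof.
intros hh hc; apply (hh (fun y => y <> 0)); apply (open_neq 0 (h c) hc).
Qed.

Lemma locally_locally' (c : R) (P : R -> Prop) : locally c P -> locally' c P.
Proof. intros [eps heps]; exists eps; auto. Qed.

(** * Identifiability *)

Lemma derive_zero_on (h : R -> R) (l r t a : R) :
  l < t < r -> (forall s, l < s < r -> h s = 0) -> is_derive h t a -> a = 0.
Proof.
intros ht h0 hh; apply (derive_eq_on h (fun _ => 0) l r t); trivial.
apply (is_derive_const (K := R_AbsRing) (V := R_NormedModule)).
Qed.

Lemma null_derive_const_on (h : R -> R) (l r x y : R) :
  (forall s, l < s < r -> is_derive h s 0) -> l < x < r -> l < y < r -> h x = h y.
Proof.
intros hh hx hy.
assert (hin : forall z, Rmin x y <= z <= Rmax x y -> l < z < r).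
{ intros z; unfold Rmin, Rmax; repeat destruct (Rle_dec _ _); lra. }
destruct (MVT_gen h x y (fun _ => 0)) as [c [_ hc]]; [| | lra].
- intros z hz; apply hh, hin; lra.
- intros z hz; apply continuity_pt_filterlim, (ex_derive_continuous (V := R_NormedModule)).
  exists 0; apply hh, hin, hz.
Qed.

(** Equality is proved first at regular points of [f], and then extended by continuity to the
    critical points, which are isolated. *)
Lemma same_rate_fun_eq (f g : R -> R) (d : R) :
  (forall x, ex_derive f x) -> (forall x, ex_derive g x) ->
  (forall x, continuous (Derive f) x) -> (forall x, continuous (Derive g) x) ->
  locally_invertible f -> d <> 0 ->
  (forall a b, exists c, f b = g c /\
     Derive f b * (a - d * b) = Derive g c * (a - d * c)) ->
  forall x, g x = f x.
Proof.
intros hf hg hdf hdg hinv hd hrel.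
assert (hreg : forall b, Derive f b <> 0 -> g b = f b).
{ intros b hb.
  (* Requiring [Derive g c <> 0] makes the candidates isolated although [g] may have flat regions.
     It holds for the given [c] because [a > d * b] on the chosen interval. *)
  destruct (discrete_cover (fun c => g c = f b /\ Derive g c <> 0)
     (fun a c => Derive f b * (a - d * b) - Derive g c * (a - d * c) = 0)
     (d * b) (d * b + 1)) as [c [p [q [[hc _] [_ [hpq [_ hP]]]]]]].
  - lra.
  - intros c [hc hc'].
    generalize (level_set_isolated g c hg
      (locally_locally' _ _ (locally_nonzero (Derive g) c (hdg c) hc'))).
    apply filter_imp; intros y hy [h1 _]; apply hy; congruence.
  - intros c _; apply closed_zero_set; intros a.
    apply (ex_derive_continuous (V := R_NormedModule)); auto_derive; trivial.
  - intros a ha; destruct (hrel a b) as [c [h1 h2]]; exists c.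
    split; [split; [congruence |] | lra].
    intros h0; rewrite h0, Rmult_0_l in h2.
    apply Rmult_integral in h2; lra.
  (* The relation is affine in [a], so two values of [a] identify both the slope and the constant
     term. *)
  - assert (e1 := hP ((2 * p + q) / 3) ltac:(lra)).
    assert (e2 := hP ((p + 2 * q) / 3) ltac:(lra)).
    assert (hslope : Derive f b = Derive g c).
    { apply Rmult_eq_reg_r with ((q - p) / 3); [| lra]; nra. }
    rewrite <- hslope in e1.
    assert (hbc : Derive f b * (d * (c - b)) = 0) by lra.
    apply Rmult_integral in hbc; destruct hbc as [hbc | hbc]; [tauto |].
    apply Rmult_integral in hbc; destruct hbc as [hbc | hbc]; [tauto |].
    replace b with c by lra; replace b with c in hc by lra; exact hc. }
intros x; destruct (Req_dec (Derive f x) 0) as [h0 | h0]; [| apply hreg, h0].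
assert (hz : locally' x (fun y => g y - f y = 0)).
{ generalize (hinv x h0); apply filter_imp; intros y hy.
  rewrite (hreg y hy); ring. }
assert (hc : continuous (fun y => g y - f y) x).
{ apply (ex_derive_continuous (V := R_NormedModule)); auto_derive; auto. }
assert (hl : g x - f x = 0).
{ apply (filterlim_locally_unique (F := Rbar_locally' x) (fun y => g y - f y)).
  - intros P hP; destruct (hc P hP) as [eps heps]; exists eps; intros y hy _; apply heps, hy.
  - apply (filterlim_ext_loc (fun _ => 0)); [| apply filterlim_const].
    revert hz; apply filter_imp; intros y hy; symmetry; exact hy. }
lra.
Qed.

(** Level sets of [f] are discrete, while those of [g] need not be. The Baire argument therefore
    selects the hidden state [b] of [f] while [c] varies. *)
Lemma rate_eq (f g : R -> R) (d e : R) :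
  (forall x, ex_derive f x) -> (forall x, ex_derive g x) ->
  (forall x, continuous (Derive f) x) -> (forall x, continuous (Derive g) x) ->
  locally_invertible f -> d <> 0 ->
  (forall a b, exists c, f b - g c = (d - e) * a) ->
  (forall a c, exists b, f b - g c = (d - e) * a /\
     Derive f b * (a - d * b) - Derive g c * (a - e * c) = (d - e) * (f b - d * a)) ->
  d = e.
Proof.
intros hf hg hdf hdg hinv hd hsurj hrel.
apply NNPP; intros hde.
set (D := d - e); assert (hD : D <> 0) by (unfold D; lra).
assert (hcrit : forall b, locally' b (fun y => Derive f y <> 0)).
{ intros b; destruct (Req_dec (Derive f b) 0) as [h0 | h0]; [apply hinv, h0 |].
  apply locally_locally', locally_nonzero; auto. }
(* At level [f b = y] the observed value is [a = (y - g c) / D]; the equation is the second relation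
   multiplied by [D], with [a] eliminated. *)
assert (hcover : forall y l r, l < r -> exists b p q,
  f b = y /\ l <= p /\ p < q /\ q <= r /\ forall c, p < c < q ->
  Derive f b * (y - g c - D * d * b) - Derive g c * (y - g c - D * e * c)
    - D ^ 2 * y + D * d * (y - g c) = 0).
{ intros y l r hlr.
  apply (discrete_cover (fun b => f b = y) (fun c b => 
    Derive f b * (y - g c - D * d * b) - Derive g c * (y - g c - D * e * c)
    - D ^ 2 * y + D * d * (y - g c) = 0) l r hlr).
  - intros b hb; generalize (level_set_isolated f b hf (hcrit b)).
    apply filter_imp; intros z hz; rewrite <- hb; exact hz.
  - intros b _; apply closed_zero_set; intros c.
    assert (hgc : continuous g c) by apply (ex_derive_continuous (V := R_NormedModule)), hg.
    assert (hdgc := hdg c); unfold continuous in *.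
    assert (hid : filterlim (fun t : R => t) (locally c) (locally c)) by apply filterlim_id.
    limits.
  - intros c _; destruct (hrel ((y - g c) / D) c) as [b [h1 h2]]; fold D in h1, h2.
    assert (hb : f b = y).
    { replace (D * ((y - g c) / D)) with (y - g c) in h1 by (field; exact hD); lra. }
    exists b; split; [exact hb |]; rewrite hb in h2.
    set (a := (y - g c) / D) in *.
    assert (ha : y - g c = D * a) by (unfold a; field; exact hD).
    rewrite ha; apply (f_equal (Rmult D)) in h2; lra. }
(* Holding [b = 0] and moving [a] from 0 to 1 changes [g c] by [D] in absolute value, so [g] is not
   constant. *)
assert (hc0 : exists c, Derive g c <> 0).
{ apply NNPP; intros hno.
  destruct (hsurj 0 0) as [c1 h1]; destruct (hsurj 1 0) as [c2 h2].
  set (m := Rabs c1 + Rabs c2 + 1).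
  assert (hm1 := Rle_abs c1); assert (hm2 := Rle_abs c2).
  assert (hm3 := Rle_abs (- c1)); assert (hm4 := Rle_abs (- c2)).
  rewrite Rabs_Ropp in hm3, hm4.
  assert (hm5 := Rabs_pos c1); assert (hm6 := Rabs_pos c2).
  assert (hg12 : g c1 = g c2).
  { apply (null_derive_const_on g (- m) m); [| unfold m; lra | unfold m; lra].
    intros s _; replace 0 with (Derive g s); [apply Derive_correct, hg |].
    apply NNPP; intros hs; apply hno; exists s; exact hs. }
  lra. }
destruct hc0 as [c0 hc0].
destruct (locally_nonzero (Derive g) c0 (hdg c0) hc0) as [eps heps].
assert (hpos := cond_pos eps).
destruct (hcover 0 (c0 - eps) (c0 + eps)) as [b0 [l0 [r0 [_ [hl0 [hlr0 [hr0 R0]]]]]]]; [lra |].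
(* Level 1 is treated inside the interval found for level 0, so both equations hold on [(l, r)];
   their difference is [hode]. *)
destruct (hcover 1 l0 r0 hlr0) as [b1 [l [r [_ [hl [hlr [hr R1]]]]]]].
assert (hnz : forall c, l < c < r -> Derive g c <> 0).
{ intros c hc; apply heps; change (Rabs (c - c0) < eps); apply Rabs_def1; lra. }
set (A := Derive f b0 - Derive f b1).
set (B := Derive f b1 * (1 - D * d * b1) + Derive f b0 * (D * d * b0) - D ^ 2 + D * d).
assert (hode : forall c, l < c < r -> Derive g c = A * g c + B).
{ intros c hc; specialize (R0 c ltac:(lra)); specialize (R1 c hc); unfold A, B; lra. }
assert (hquad : forall c, l < c < r ->
  (A * g c + B) * (g c + D * e * c) - (D * d + Derive f b0) * g c
    - Derive f b0 * (D * d * b0) = 0).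
{ intros c hc; rewrite <- (hode c hc); specialize (R0 c ltac:(lra)); lra. }
(* Differentiating [hquad] and using [hode] produces a common factor [Derive g c], which is nonzero
   here. *)
assert (hlin : forall c, l < c < r ->
  A * (g c + D * e * c) + (A * g c + B) + D * e - (D * d + Derive f b0) = 0).
{ intros c hc.
  apply Rmult_eq_reg_l with (Derive g c); [| apply hnz, hc]; rewrite Rmult_0_r.
  apply (derive_zero_on _ l r c _ hc hquad).
  auto_derive; [auto |].
  change (Derive (fun x => g x) c) with (Derive g c); rewrite (hode c hc); ring. }
assert (hA : A = 0).
{ apply NNPP; intros hA.
  (* Differentiating [hlin] gives [A] times this expression; one more differentiation leaves
     [2 * A * Derive g c = 0]. *)
  assert (hcst : forall c, l < c < r -> 2 * (A * g c + B) + D * e = 0).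
  { intros c hc; apply Rmult_eq_reg_l with A; [| exact hA]; rewrite Rmult_0_r.
    apply (derive_zero_on _ l r c _ hc hlin).
    auto_derive; [auto |].
    change (Derive (fun x => g x) c) with (Derive g c); rewrite (hode c hc); ring. }
  assert (hm : l < (l + r) / 2 < r) by lra.
  apply (hnz _ hm).
  apply Rmult_eq_reg_l with (2 * A); [| lra]; rewrite Rmult_0_r.
  apply (derive_zero_on _ l r _ _ hm hcst).
  auto_derive; [auto |].
  change (Derive (fun x => g x) ((l + r) / 2)) with (Derive g ((l + r) / 2)); ring. }
assert (hslope : forall c, l < c < r -> Derive g c = B).
{ intros c hc; rewrite (hode c hc), hA; ring. }
set (m := (l + r) / 2); assert (hm : l < m < r) by (unfold m; lra).
assert (hB : B <> 0) by (rewrite <- (hslope m hm); apply hnz, hm).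
set (G := g m - B * m).
assert (haff : forall c, l < c < r -> g c = B * c + G).
{ intros c hc.
  assert (h := null_derive_const_on (fun s => g s - B * s) l r c m).
  unfold G; rewrite <- h; [ring | | exact hc | exact hm].
  intros s hs; auto_derive; [auto |].
  change (Derive (fun x => g x) s) with (Derive g s); rewrite (hslope s hs); ring. }
(* With [g] affine the relation is affine in [c]: its slope gives [Derive f b], and its value then
   gives the equation for [b]. *)
assert (hlevel : forall y, exists b,
  f b = y /\ Derive f b = B - D ^ 2 /\ d * b * (B - D ^ 2) = (e - D) * y - e * G).
{ intros y; destruct (hcover y l r hlr) as [b [p [q [hb [hp [hpq [hq Ry]]]]]]].
  assert (Ry' : forall c, p < c < q -> Derive f b * (y - (B * c + G) - D * d * b)
    - B * (y - (B * c + G) - D * e * c) - D ^ 2 * y + D * d * (y - (B * c + G)) = 0).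
  { intros c hc; rewrite <- haff, <- (hslope c) by lra; apply Ry, hc. }
  assert (hn : p < (p + q) / 2 < q) by lra.
  assert (hfb : Derive f b = B - D ^ 2).
  { apply Rmult_eq_reg_l with (- B); [| lra]; apply Rminus_diag_uniq.
    apply (derive_zero_on _ p q _ _ hn Ry').
    auto_derive; [trivial |].
    unfold D; ring. }
  exists b; split; [exact hb | split; [exact hfb |]].
  specialize (Ry' _ hn); rewrite hfb in Ry'.
  apply Rmult_eq_reg_l with D; [| exact hD].
  unfold D in *; lra. }
destruct (Req_dec (B - D ^ 2) 0) as [h0 | h0].
(* Every level would contain a critical point. These are isolated, so a single one would have to
   serve a whole interval of levels. *)
- destruct (discrete_cover (fun b => Derive f b = 0) (fun y b => f b - y = 0) 0 1)
    as [b [p [q [_ [_ [hpq [_ hP]]]]]]].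
  + lra.
  + intros b _; exact (hcrit b).
  + intros b _; apply closed_zero_set; intros y.
    apply (ex_derive_continuous (V := R_NormedModule)); auto_derive; trivial.
  + intros y _; destruct (hlevel y) as [b [h1 [h2 _]]]; exists b; split; lra.
  + assert (e1 := hP ((2 * p + q) / 3) ltac:(lra)).
    assert (e2 := hP ((p + 2 * q) / 3) ltac:(lra)); lra.
(* Solving [hlevel] for [b] shows that [lam * y + mu] is an affine right inverse of [f].
   Differentiating gives [e - D = d], that is [d = e]. *)
- set (lam := (e - D) / (d * (B - D ^ 2))); set (mu := - (e * G) / (d * (B - D ^ 2))).
  assert (hb : forall y, f (lam * y + mu) = y /\ Derive f (lam * y + mu) = B - D ^ 2).
  { intros y; destruct (hlevel y) as [b [h1 [h2 h3]]].
    replace (lam * y + mu) with b; [auto |].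
    apply Rmult_eq_reg_l with (d * (B - D ^ 2)); [| apply Rmult_integral_contrapositive; auto].
    unfold lam, mu; field_simplify; [lra | auto]. }
  assert (hinv1 : lam * (B - D ^ 2) - 1 = 0).
  { apply (derive_zero_on (fun y => f (lam * y + mu) - y) (-1) 1 0); [lra | |].
    - intros s _; rewrite (proj1 (hb s)); ring.
    - auto_derive; [auto |].
      change (Derive (fun x => f x)) with (Derive f); rewrite (proj2 (hb 0)); ring. }
  assert (hed : e - D = d).
  { apply Rmult_eq_reg_r with (/ d); [| apply Rinv_neq_0_compat; exact hd].
    rewrite Rinv_r by exact hd; unfold lam in hinv1.
    apply Rminus_diag_uniq; rewrite <- hinv1; field; auto. }
  unfold D in hed; lra.
Qed.

Theorem proposition4p1 (u : unknowns) (hu : admissible u) :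
  (structurally_identifiable observe_X2 fun_f u /\
   structurally_identifiable observe_X2 par_d u) /\
  (locally_invertible (fun_f u) -> par_d u <> 0 ->
   structurally_identifiable observe_X1 fun_f u /\
   structurally_identifiable observe_X1 par_d u).
Proof.
split.
- assert (key : forall v, admissible v -> same_outputs observe_X2 u v ->
    fun_f v = fun_f u /\ par_d v = par_d u).
  { intros v hv [huv _].
    assert (hrel := observe_X2_relation u v hu hv huv).
    assert (hd : par_d v = par_d u).
    (* Only the coefficient [2 * (d - e)] of [y] survives in the difference of these two
       instances. *)
    { assert (h0 := hrel 0 0); assert (h1 := hrel 0 1); lra. }
    split; [| exact hd].
    apply functional_extensionality; intros x.
    assert (h := hrel x 0); rewrite hd in h; lra. }
  split; intros v hv hs; apply (key v hv hs).
- intros hinv hd.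
  assert (key : forall v, admissible v -> same_outputs observe_X1 u v ->
    fun_f v = fun_f u /\ par_d v = par_d u).
  { intros v hv [huv hvu].
    assert (r1 := observe_X1_relation u v hu hv huv).
    assert (r2 := observe_X1_relation v u hv hu hvu).
    destruct u as [f d]; destruct v as [g e]; unfold admissible in *; simpl in *.
    assert (hde : d = e).
    { apply (rate_eq f g d e); try assumption; try (intros x; apply hu); try (intros x; apply hv).
      - intros a b; destruct (r1 a b) as [c [h _]]; exists c; exact h.
      - intros a c; destruct (r2 a c) as [b [h1 h2]]; exists b; split; [lra |].
        replace (f b) with (g c + (d - e) * a) by lra; lra. }
    split; [| auto].
    apply functional_extensionality; apply (same_rate_fun_eq f g d); try assumption;
      try (intros x; apply hu); try (intros x; apply hv).
    intros a b; destruct (r1 a b) as [c [h1 h2]]; subst e; exists c; split; lra. }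
  split; intros v hv hs; apply (key v hv hs).
Qed.
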